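(* Let $\mathcal M$ be a minion on a pair of finite sets. The following are equivalent: (1) there exist $K\ge2$ and a minion homomorphism $\xi\colon\mathcal M\to\mathrm{Pol}(\mathbf H_2,\mathbf H_K)$; (2) $\mathcal M$ does not contain an Olšák function.
   Context: $\mathbf H_K$ has domain $\{0,\dots,K-1\}$ and one ternary relation $\{0,\dots,K-1\}^3\setminus\{(a,a,a)\}$. $\mathrm{Pol}(\mathbf A,\mathbf B)$ is the set of all homomorphisms $\mathbf A^n\to\mathbf B$, where $\mathbf A^n$ has domain $A^n$ and relations consisting of the tuples of rows of matrices whose columns lie in the corresponding relation of $\mathbf A$. A minion on $(A,B)$ is a nonempty set of functions $A^n\to B$ closed under minors $g\mapsto g(x_{\pi(1)},\dots,x_{\pi(m)})$ for $\pi\colon[m]\to[n]$; a minion homomorphism preserves arities and minors. An Olšák function is a $6$-ary function $o$ satisfying $o(x,x,y,y,y,x)=o(x,y,x,y,x,y)=o(y,x,x,x,y,y)$ for all $x,y$. *)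

(* Defs.v *)
From mathcomp Require Import all_boot.

Set Implicit Arguments.
Unset Strict Implicit.
Unset Printing Implicit Defensive.

(* Functions A^n -> B.  The arity n = 0 is allowed.  Minions all of whose
   members have positive arity are exactly those with no member of arity 0:
   there is no map [m] -> [0] with m > 0, so closure under minors never forces
   a nullary member. *)
Definition op (A B : finType) (n : nat) : Type := {ffun n.-tuple A -> B}.

Definition minor (A B : finType) (m n : nat) (p : 'I_m -> 'I_n)
    (g : op A B m) : op A B n :=
  [ffun x : n.-tuple A => g [tuple tnth x (p i) | i < m]].

Definition op_set (A B : finType) := forall n : nat, op A B n -> Prop.

Definition is_minion (A B : finType) (M : op_set A B) : Prop :=
  (exists (n : nat) (f : op A B n), M n f) /\
  (forall (m n : nat) (p : 'I_m -> 'I_n) (g : op A B m),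
     M m g -> M n (minor p g)).

Definition member (A B : finType) (M : op_set A B) (n : nat) : Type :=
  {f : op A B n | M n f}.

(* Minor preservation is stated on the underlying functions: an equation between
   elements of the sigma type would also compare membership proofs.  With p the
   identity it says that xi does not depend on the membership proof. *)
Definition is_minion_hom (A B C D : finType) (M : op_set A B) (N : op_set C D)
    (xi : forall n : nat, member M n -> member N n) : Prop :=
  forall (m n : nat) (p : 'I_m -> 'I_n) (f : member M m) (g : member M n),
    sval g = minor p (sval f) -> sval (xi n g) = minor p (sval (xi m f)).

Record signature := Signature { symbol : Type; arity : symbol -> nat }.

Record structure (S : signature) := Structure {
  dom : finType;
  rel_of : forall R : symbol S, (arity R).-tuple dom -> Prop
}.

(* t is the list of rows of an (arity R) x n matrix over dom X. *)
Definition power (S : signature) (X : structure S) (n : nat) : structure S :=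
  @Structure S (n.-tuple (dom X))
    (fun (R : symbol S) (t : (arity R).-tuple (n.-tuple (dom X))) =>
       forall j : 'I_n, rel_of [tuple tnth (tnth t i) j | i < arity R]).

Definition is_hom (S : signature) (X Y : structure S) (h : dom X -> dom Y) : Prop :=
  forall (R : symbol S) (t : (arity R).-tuple (dom X)),
    rel_of t -> rel_of [tuple h (tnth t i) | i < arity R].

Definition Pol (S : signature) (X Y : structure S) : op_set (dom X) (dom Y) :=
  fun (n : nat) (f : op (dom X) (dom Y) n) => is_hom (X := power X n) f.
Arguments Pol {S} X Y n f.

Definition ternary : signature := @Signature unit (fun _ => 3).

Definition H (K : nat) : structure ternary :=
  @Structure ternary 'I_K
    (fun (_ : unit) (t : 3.-tuple 'I_K) => ~ exists a : 'I_K, t = [tuple a; a; a]).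

Definition olsak (A B : finType) (o : op A B 6) : Prop :=
  forall x y : A,
    o [tuple x; x; y; y; y; x] = o [tuple x; y; x; y; x; y] /\
    o [tuple x; y; x; y; x; y] = o [tuple y; x; x; x; y; y].

(* Main.v *)
Require Import Defs.
From mathcomp Require Import all_boot.

Set Implicit Arguments.
Unset Strict Implicit.
Unset Printing Implicit Defensive.

(** The six columns of the 3 x 6 matrix formed by the Olšák identities are
    exactly the tuples of the relation of H_2, so a member of M of arity 6 is an
    Olšák function iff its three binary minors along the rows coincide.  For an
    arbitrary f in M, sending t in {0,1}^n to the binary minor of f along t maps
    three rows with columns in H_2 to three such row minors of a single 6-ary
    minor of f.  If M has no Olšák function these are never all equal, and any
    injective numbering of the finitely many binary functions yields (1). *)

Lemma minor_comp (A B : finType) (m n k : nat) (p : 'I_m -> 'I_n)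
    (q : 'I_n -> 'I_k) (f : op A B m) :
  minor q (minor p f) = minor (q \o p) f.
Proof.
apply/ffunP=> x; rewrite !ffunE; congr (f _).
by apply: eq_from_tnth => i; rewrite !tnth_mktuple.
Qed.

Lemma eq_minor (A B : finType) (m n : nat) (p q : 'I_m -> 'I_n) (f : op A B m) :
  p =1 q -> minor p f = minor q f.
Proof.
move=> epq; apply/ffunP=> x; rewrite !ffunE; congr (f _).
by apply: eq_from_tnth => i; rewrite !tnth_mktuple epq.
Qed.

(** The three sides of the Olšák identities, with [o] standing for the variable x and [l] for y. *)
Definition olsak_rows : 3.-tuple (6.-tuple 'I_2) :=
  let o := ord0 in let l := ord_max in
  [tuple [tuple o; o; l; l; l; o]; [tuple o; l; o; l; o; l];
         [tuple l; o; o; o; l; l]].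

Definition olsak_row (i : 'I_3) : 'I_6 -> 'I_2 := tnth (tnth olsak_rows i).

Lemma olsak_row_NAE (c : 'I_6) (a : 'I_2) :
  ~ (forall i : 'I_3, olsak_row i c = a).
Proof.
move=> E; move: (E ord0) (E (inord 1)) (E ord_max) => <-.
rewrite /olsak_row !(tnth_nth ord0) !(tnth_nth [tuple of nseq 6 ord0]) inordK //.
by case: c {E} => [[|[|[|[|[|[|//]]]]]] ?].
Qed.

Lemma NAE_olsak_row (u : 'I_3 -> 'I_2) :
  ~ (exists a, forall i, u i = a) ->
  exists c, forall i, olsak_row i c = u i.
Proof.
move=> NAE.
have ord3P (P : 'I_3 -> Prop) : P ord0 -> P (inord 1) -> P ord_max -> forall i, P i.
  move=> P0 P1 P2 [[|[|[|//]]] lti].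
  - by rewrite (_ : Ordinal lti = ord0) //; apply: val_inj.
  - by rewrite (_ : Ordinal lti = inord 1) //; apply: val_inj; rewrite /= inordK.
  - by rewrite (_ : Ordinal lti = ord_max) //; apply: val_inj.
suff [c [c0 c1 c2]] : exists c, [/\ olsak_row ord0 c = u ord0,
    olsak_row (inord 1) c = u (inord 1) & olsak_row ord_max c = u ord_max].
  by exists c; apply: ord3P.
have {ord3P NAE} : ~ (u ord0 = u (inord 1) /\ u (inord 1) = u ord_max).
  by case=> e01 e12; apply: NAE; exists (u ord0); apply: ord3P; rewrite ?e01 ?e12.
have ord2P (b : 'I_2) : b = ord0 \/ b = ord_max.
  by case: b => [[|[|//]] ltb]; [left|right]; apply: val_inj.
have rowE (k : nat) (ltk : k < 3) c : olsak_row (inord k) c =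
    nth ord0 (nth [tuple of nseq 6 ord0] olsak_rows k) c.
  by rewrite /olsak_row (tnth_nth ord0) (tnth_nth [tuple of nseq 6 ord0]) inordK.
have -> : @ord0 2 = inord 0 by apply: val_inj; rewrite /= inordK.
have -> : @ord_max 2 = inord 2 by apply: val_inj; rewrite /= inordK.
(* The cases run through 000, 001, ..., 111. The two constant triples contradict [NAE]; each witness
   is the position of the triple among the columns of [olsak_rows]. *)
by case: (ord2P (u (inord 0))) => ->; case: (ord2P (u (inord 1))) => ->;
   case: (ord2P (u (inord 2))) => -> NAE;
   [case: NAE | exists (inord 0) | exists (inord 1) | exists (inord 5)
   |exists (inord 2) | exists (inord 4) | exists (inord 3) | case: NAE];
   rewrite ?rowE ?inordK.
Qed.

(** At the pair (x, y), the minor along row i takes the value of the i-th side of the identities.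
    Phrased through minors alone, the property can be carried along minion homomorphisms. *)
Lemma olsak_minorP (A B : finType) (o : op A B 6) :
  olsak o <-> exists g, forall i, minor (olsak_row i) o = g.
Proof.
have rowE (i : 'I_3) (x : 2.-tuple A) : minor (olsak_row i) o x =
    o (map_tuple (tnth x) (tnth olsak_rows i)).
  by rewrite ffunE; congr (o _); apply: eq_from_tnth => j; rewrite tnth_mktuple tnth_map.
have mapE (x y : A) : [/\
    map_tuple (tnth [tuple x; y]) (tnth olsak_rows ord0) = [tuple x; x; y; y; y; x],
    map_tuple (tnth [tuple x; y]) (tnth olsak_rows (inord 1)) = [tuple x; y; x; y; x; y]
  & map_tuple (tnth [tuple x; y]) (tnth olsak_rows ord_max) = [tuple y; x; x; x; y; y]].
  split; rewrite (tnth_nth [tuple of nseq 6 ord0]) ?inordK //;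
  apply: val_inj => /=; by rewrite !(tnth_nth x).
split=> [ols | [g E] x y].
  exists (minor (olsak_row ord0) o) => i; apply/ffunP=> x.
  have {x} [a [b ->]] : exists a b, x = [tuple a; b].
    exists (tnth x ord0), (tnth x ord_max); apply: eq_from_tnth => j.
    by rewrite [RHS](tnth_nth (tnth x ord0)); case: j => [[|[|//]] ltj];
       congr tnth; apply: val_inj.
  rewrite !rowE; have [e0 e1 e2] := mapE a b; have [o01 o12] := ols a b.
  rewrite e0; case: i => [[|[|[|//]]] lti].
  - by rewrite (_ : Ordinal lti = ord0) ?e0 //; apply: val_inj.
  - rewrite (_ : Ordinal lti = inord 1) ?e1 //.
    by apply: val_inj; rewrite /= inordK.
  - by rewrite (_ : Ordinal lti = ord_max) ?e2 ?o01 //; apply: val_inj.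
by have [<- <- <-] := mapE x y; rewrite -!rowE !E.
Qed.

Lemma const_3tupleP (T : Type) (u : 'I_3 -> T) (a : T) :
  [tuple u i | i < 3] = [tuple a; a; a] <-> forall i, u i = a.
Proof.
have aE i : tnth [tuple a; a; a] i = a.
  by rewrite (tnth_nth a); case: i => [[|[|[|]]]].
split=> [E i | E]; first by rewrite -(aE i) -E tnth_mktuple.
by apply: eq_from_tnth => i; rewrite tnth_mktuple aE.
Qed.

(** With rows indexed by a function on ['I_3], each column becomes a function ['I_3 -> 'I_2], as
    [NAE_olsak_row] expects. *)
Lemma Pol_H2P (K n : nat) (h : op 'I_2 'I_K n) :
  Pol (H 2) (H K) n h <->
  forall t : 'I_3 -> n.-tuple 'I_2,
    (forall j, ~ exists a, forall i, tnth (t i) j = a) ->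
    ~ exists a, forall i, h (t i) = a.
Proof.
split=> [hP t NAE [a E] | hP [] t NAE [a /const_3tupleP E]].
  apply: (hP tt [tuple t i | i < 3]) => [j [b /const_3tupleP Eb] | ].
    by apply: (NAE j); exists b => i; rewrite -(Eb i) tnth_mktuple.
  by exists a; apply/const_3tupleP => i; rewrite tnth_mktuple.
apply: (hP (tnth t)); last by exists a.
by move=> j [b Eb]; apply: (NAE j); exists b; apply/const_3tupleP.
Qed.

Lemma Pol_H2_not_olsak (K : nat) (h : op 'I_2 'I_K 6) :
  Pol (H 2) (H K) 6 h -> ~ olsak h.
Proof.
move=> /Pol_H2P hP /olsak_minorP [g E].
apply: (hP (tnth olsak_rows)) => [j [a Ea] | ]; first exact: (olsak_row_NAE Ea).
(* At the pair (0, 1), the minor of [h] along a row is the value of [h] at that row. *)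
exists (g [tuple i | i < 2]) => i; rewrite -(E i) ffunE; congr (h _).
by apply: eq_from_tnth => j; rewrite !tnth_mktuple.
Qed.

Lemma minion_hom_olsak (A B C D : finType) (M : op_set A B) (N : op_set C D)
    (xi : forall n, member M n -> member N n) (o : member M 6) :
  is_minion M -> is_minion_hom xi ->
  olsak (sval o) -> olsak (sval (xi 6 o)).
Proof.
move=> [_ minM] xiP /olsak_minorP [g E]; apply/olsak_minorP.
(* The common minor lies in [M], so [xi] applies to it, and its image is the common row minor of the
   image of [o]. *)
have Mg : M 2 g by rewrite -(E ord0); apply/minM/(svalP o).
exists (sval (xi 2 (exist _ g Mg))) => i.
by rewrite -(xiP _ _ _ o (exist _ g Mg)) //= (E i).
Qed.

Definition binary_minors (A B : finType) (K : nat) (iota : op A B 2 -> 'I_K)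
    (n : nat) (f : op A B n) : op 'I_2 'I_K n :=
  [ffun t => iota (minor (tnth t) f)].

Lemma binary_minors_minor (A B : finType) (K : nat) (iota : op A B 2 -> 'I_K)
    (m n : nat) (p : 'I_m -> 'I_n) (f : op A B m) :
  binary_minors iota (minor p f) =
  minor p (binary_minors iota f).
Proof.
apply/ffunP=> t; rewrite !ffunE minor_comp; congr iota.
by apply: eq_minor => i; rewrite tnth_mktuple.
Qed.

Lemma Pol_binary_minors (A B : finType) (M : op_set A B) (K : nat)
    (iota : op A B 2 -> 'I_K) (n : nat) (f : op A B n) :
  is_minion M -> injective iota ->
  ~ (exists o : op A B 6, M 6 o /\ olsak o) ->
  M n f -> Pol (H 2) (H K) n (binary_minors iota f).
Proof.
move=> [_ minM] iota_inj noOls Mf; apply/Pol_H2P => t NAE [a E].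
(* [p] sends j to the Olšák column equal to the j-th column of [t]. Hence row i after [p] is [t i],
   and the minors of [f] along the [t i] are the row minors of [minor p f]. *)
have [p pE] := fin_all_exists (fun j => NAE_olsak_row (NAE j)).
apply: noOls; exists (minor p f); split; first exact: minM.
apply/olsak_minorP; exists (minor (tnth (t ord0)) f) => i.
rewrite minor_comp (@eq_minor _ _ _ _ _ (tnth (t i))); last by move=> j; apply: pE.
by apply: iota_inj; move: (E i) (E ord0); rewrite !ffunE => -> ->.
Qed.

Theorem theorem6p2 (A B : finType) (M : op_set A B) (minM : is_minion M) :
  (exists (K : nat) (xi : forall n : nat, member M n -> member (Pol (H 2) (H K)) n),
     2 <= K /\ is_minion_hom xi)
  <->
  ~ (exists o : op A B 6, M 6 o /\ olsak o).
Proof.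
split=> [[K [xi [_ xiP]]] [o [Mo ols]] | noOls].
  pose om : member M 6 := exist _ o Mo.
  by apply: (Pol_H2_not_olsak (svalP (xi 6 om))); apply: (minion_hom_olsak minM xiP).
(* The shift by 2 secures [2 <= K] even when there are fewer than two binary functions. *)
pose iota (g : op A B 2) := rshift 2 (enum_rank g).
have iota_inj : injective iota by move=> g g' /rshift_inj/enum_rank_inj.
exists (2 + #|{ffun 2.-tuple A -> B}|), (fun n f => exist _ _
  (Pol_binary_minors minM iota_inj noOls (svalP f))).
split=> [|m n p f g /= ->]; first exact: leq_addr.
exact: binary_minors_minor.
Qed.
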